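(* Let $G$ be a finite group and let $\tilde\rho_h$ ($h\in G$) be the generalized hidden shift states of $G$ with $m=|G|$. For $g,h\in G$ let $$r(g,h):=\frac{|\{b\in\mathbb{Z}/|G| : h^b=g^b\}|}{|G|}.$$ For every integer $k\ge 1$, the success probability $p_{\mathrm{PGM}}$ of the pretty good measurement for the $k$-copy ensemble $\{(\tfrac1{|G|},\tilde\rho_h^{\otimes k})\}_{h\in G}$ satisfies $$1-p_{\mathrm{PGM}}\le \frac{1}{|G|}\sum_{g\neq h\in G} r(g,h)^{k/2}.$$ Moreover, there is an absolute constant $\epsilon>0$ (independent of $G$) such that $$k_{\min}\le \min\Big\{k\ge 1 : \frac{1}{|G|}\sum_{g\ne h\in G} r(g,h)^{k}\le \epsilon\Big\}.$$ (Sums run over ordered pairs $(g,h)\in G\times G$ with $g\neq h$.)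
   Context: Generalized hidden shift states: for a finite group $G$ and $m=|G|$, let $\mathrm{reg}_G$ be the regular representation of $G$ on $\mathbb{C}[G]$ and, for $h\in G$, define the density operator on $\mathbb{C}^{m}\otimes\mathbb{C}[G]$ $$\tilde\rho_h=\frac{1}{m|G|}\sum_{b,c\in\mathbb{Z}/m}|b\rangle\langle c|\otimes \mathrm{reg}_G(h^{b-c}).$$ (Up to a unitary independent of $h$, this is $\frac1{|G|}\sum_{g\in G}|\phi_{g,h}\rangle\langle\phi_{g,h}|$ with $|\phi_{g,h}\rangle=\frac1{\sqrt m}\sum_{b\in\mathbb{Z}/m}|b,gh^b\rangle$, the state obtained by querying an oracle $f:\{0,\dots,m-1\}\times G\to S$, injective in the second argument and satisfying $f(i,g)=f(i+1,gh)$.) For an ensemble $(p_i,\sigma_i)_i$ the optimal success probability is $p^*_{\mathrm{succ}}=\max\{\sum_i p_i\mathrm{tr}(M_i\sigma_i): M_i\ge0,\ \sum_iM_i=\mathbb 1\}$. The pretty good measurement is $M_i=p_i\bar\sigma^{-1/2}\sigma_i\bar\sigma^{-1/2}$, where $\bar\sigma=\sum_ip_i\sigma_i$ and the inverse is taken on the support of $\bar\sigma$ (to which the Hilbert space is restricted); its success probability is $p_{\mathrm{PGM}}=\sum_ip_i\mathrm{tr}(M_i\sigma_i)$. Sample complexity: $k_{\min}$ is the least $k\ge1$ such that the ensemble $\{(\tfrac1{|G|},\tilde\rho_h^{\otimes k})\}_{h\in G}$ has $p^*_{\mathrm{succ}}\ge\frac23$. *)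

(* Defs.v *)
From mathcomp Require Export all_boot all_order all_algebra all_fingroup.
From mathcomp Require Export spectral sesquilinear mxrepresentation.
From mathcomp Require Export complex mxtens.
From mathcomp Require Export boolp classical_sets reals exp.

Set Implicit Arguments.
Unset Strict Implicit.
Unset Printing Implicit Defensive.

Import Order.TTheory GRing.Theory Num.Theory.
Local Open Scope ring_scope.
Local Open Scope complex_scope.
Local Open Scope sesquilinear_scope.

Notation "A *t B" := (tensmx A B)
  (at level 40, left associativity, format "A  *t  B") : ring_scope.

(* The dimension d ^ k is written as an iterated product so that it unfolds
   definitionally along the tensor power. *)
Fixpoint tenspow (K : pzRingType) (d : nat) (A : 'M[K]_d) (k : nat) :
    'M[K]_(iter k (muln d) 1%N) :=
  if k is k'.+1 then A *t tenspow A k' else 1%:M.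

(* Over the complex numbers 0 <= z means that z is real and nonnegative, so
   this condition also forces A to be Hermitian. *)
Definition psdmx (K : numClosedFieldType) (n : nat) (A : 'M[K]_n) : Prop :=
  forall v : 'cV[K]_n, 0 <= (v^t* *m A *m v) 0 0.

(* A^{-1/2} on the support of A and 0 on its orthogonal complement, for A
   positive semidefinite: the functional calculus applied to x |-> x^{-1/2},
   where sqrtC 0 = 0 and 0^-1 = 0. *)
Definition invsqrtmx (K : numClosedFieldType) (n : nat) (A : 'M[K]_n) :
    'M[K]_n :=
  invmx (spectralmx A) *m
  diag_mx (map_mx (fun x => (sqrtC x)^-1) (spectral_diag A)) *m
  spectralmx A.

(* An ensemble is a family of weights p and matrices sigma indexed by A. *)
Section Ensembles.
Variables (R : realType) (I : finType) (A : {set I}) (n : nat).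
Implicit Types (p : I -> R) (sigma M : I -> 'M[R[i]]_n).

Definition povm M : Prop :=
  {in A, forall i, psdmx (M i)} /\ \sum_(i in A) M i = 1%:M.

(* \tr (M i *m sigma i) is real when M i and sigma i are positive
   semidefinite; Re only changes its type. *)
Definition success_prob p sigma M : R :=
  \sum_(i in A) p i * complex.Re (\tr (M i *m sigma i)).

(* The set of POVMs is compact, so this supremum is a maximum. *)
Definition opt_success p sigma : R :=
  sup [set x | exists2 M, povm M & x = success_prob p sigma M]%classic.

Definition avg_state p sigma : 'M[R[i]]_n :=
  \sum_(i in A) (p i)%:C *: sigma i.

(* As operators on the whole space, these sum to the projection onto the
   support of avg_state p sigma. *)
Definition pgm p sigma (i : I) : 'M[R[i]]_n :=
  (p i)%:C *: (invsqrtmx (avg_state p sigma) *m sigma i *m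
               invsqrtmx (avg_state p sigma)).

Definition pgm_success p sigma : R :=
  success_prob p sigma (pgm p sigma).

End Ensembles.

Definition is_least (P : nat -> Prop) (k : nat) : Prop :=
  P k /\ forall j, P j -> (k <= j)%N.

Section HiddenShift.
Variables (R : realType) (gT : finGroupType) (G : {group gT}).

(* Z/|G| is represented by 'I_#|G| (also right for the trivial group, unlike
   'Z_#|G|); as h ^+ #|G| = 1 for h in G, h^{b-c} is h ^+ b * h ^- c.
   The matrices of regular_repr act on row vectors by |g> |-> |g x>, hence on
   column vectors by |g> |-> |g x^-1>. *)
Definition hidden_shift_state (h : gT) : 'M[R[i]]_(#|G| * #|G|) :=
  (#|G| * #|G|)%:R^-1 *:
  \sum_(b < #|G|) \sum_(c < #|G|)
    delta_mx b c *t regular_repr R[i] G (h ^+ b * h ^- c)%g.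

Definition uniform_weight (h : gT) : R := #|G|%:R^-1.

Definition hidden_shift_copies (k : nat) (h : gT) :=
  tenspow (hidden_shift_state h) k.

Definition hidden_shift_pgm (k : nat) : R :=
  pgm_success G uniform_weight (hidden_shift_copies k).

Definition hidden_shift_opt (k : nat) : R :=
  opt_success G uniform_weight (hidden_shift_copies k).

Definition sample_complexity (k : nat) : Prop :=
  is_least (fun j => (1 <= j)%N /\ 2 / 3 <= hidden_shift_opt j) k.

Definition agreement (g h : gT) : R :=
  #|[set b : 'I_#|G| | h ^+ b == g ^+ b]%g|%:R / #|G|%:R.

End HiddenShift.

(* Main.v *)
Require Import Defs.
From mathcomp Require Import ring lra.
From mathcomp Require Import cyclic filter topology normedtype sequences.

(** A copy of the state of h is 1/|G| times a projection, so the k-copy states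
  are flat: sigma_h ^ 2 = q sigma_h with q = |G| ^ -k, and
  tr (sigma_g sigma_h) = q r(g,h) ^ k. Let p = 1/|G|, let rho be the average
  state, T = rho^{-1/2} and s = sqrt (p q). The pretty good measurement
  succeeds with probability p^2 sum_h tr (T sigma_h T sigma_h). Expanding
  0 <= tr (sigma_h T sigma_h - l sigma_h)^2 with l = s / p bounds this from
  below by 2 s tr (sqrt rho) - 1. The scalar inequality
  2 s^3 sqrt x >= 3 s^2 x - x^2 turns the trace of the square root into
  tr rho = 1 and tr rho^2 = s^2 (1 + E), where
  E = 1/|G| sum_{g <> h} r(g,h) ^ k, so that p_PGM >= 1 - E.
  As 0 <= r <= 1, this implies the bound with exponent k/2, and it gives
  p_succ >= 2/3 as soon as E <= 1/3. *)

Set Implicit Arguments.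
Unset Strict Implicit.
Unset Printing Implicit Defensive.

Import Order.TTheory GRing.Theory Num.Theory.
Import numFieldNormedType.Exports.
Local Open Scope ring_scope.
Local Open Scope sesquilinear_scope.

(** * Adjoints and positive semidefinite matrices *)

Section Hermitian.
Variable C : numClosedFieldType.

Lemma trmxC_mul (m n l : nat) (A : 'M[C]_(m, n)) (B : 'M[C]_(n, l)) :
  (A *m B)^t* = B^t* *m A^t*.
Proof. by rewrite trmx_mul map_mxM. Qed.

Lemma trmxC_scale (m n : nat) (a : C) (A : 'M[C]_(m, n)) :
  (a *: A)^t* = a^* *: A^t*.
Proof. by rewrite linearZ /= map_mxZ. Qed.

Lemma trmxC_sum (I : Type) (r : seq I) (P : pred I) (m n : nat)
    (F : I -> 'M[C]_(m, n)) :
  (\sum_(i <- r | P i) F i)^t* = \sum_(i <- r | P i) (F i)^t*.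
Proof. by rewrite raddf_sum raddf_sum. Qed.

Lemma mxtrace_mul_trmxC_ge0 (m n : nat) (X : 'M[C]_(m, n)) :
  0 <= \tr (X *m X^t*).
Proof.
apply: sumr_ge0 => i _; rewrite mxE; apply: sumr_ge0 => j _.
by rewrite !mxE mul_conjC_ge0.
Qed.

Lemma psdmx_quad (n : nat) (A : 'M[C]_n) (v : 'rV[C]_n) :
  psdmx A -> 0 <= (v *m A *m v^t*) 0 0.
Proof. by move=> /(_ (v^t*)); rewrite trmxCK. Qed.

Lemma psdmx_sandwich (n : nat) (A B : 'M[C]_n) :
  psdmx A -> psdmx (B^t* *m A *m B).
Proof.
by move=> A_psd v; rewrite !mulmxA -trmxC_mul -mulmxA; exact: A_psd.
Qed.

Lemma psdmx_mxtrace_ge0 (n : nat) (A : 'M[C]_n) : psdmx A -> 0 <= \tr A.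
Proof.
move=> A_psd; apply: sumr_ge0 => i _.
have := A_psd (delta_mx i 0).
by rewrite trmx_delta map_delta_mx -rowE -colE !mxE.
Qed.

(** By cyclicity the trace is that of B A B, with [B] Hermitian. A flat state is a multiple of its
    own square, so this covers traces against such a state. *)
Lemma psdmx_mxtrace_sandwich_ge0 (n : nat) (A B : 'M[C]_n) :
  psdmx A -> B^t* = B -> 0 <= \tr (A *m (B *m B)).
Proof.
move=> A_psd B_herm; rewrite mulmxA mxtrace_mulC mulmxA -{1}B_herm.
exact/psdmx_mxtrace_ge0/psdmx_sandwich.
Qed.

(** Here A = q^-1 A^* A, so the quadratic form at [v] is q^-1 times the squared norm of A v. *)
Lemma psdmx_hermitian_idem (n : nat) (A : 'M[C]_n) (q : C) :
  0 < q -> A^t* = A -> A *m A = q *: A -> psdmx A.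
Proof.
move=> q_gt0 A_herm A_idem v.
have -> : A = q^-1 *: (A^t* *m A).
  by rewrite A_herm A_idem scalerA mulVf ?scale1r ?gt_eqF.
rewrite -scalemxAr -scalemxAl mxE mulr_ge0 ?invr_ge0 ?(ltW q_gt0)//.
rewrite !mulmxA -trmxC_mul -mulmxA.
move: (A *m v) => w; rewrite mxE; apply: sumr_ge0 => i _.
by rewrite !mxE mulrC mul_conjC_ge0.
Qed.

Lemma psdmxZ (n : nat) (A : 'M[C]_n) (a : C) :
  0 <= a -> psdmx A -> psdmx (a *: A).
Proof.
move=> a_ge0 A_psd v.
by rewrite -scalemxAr -scalemxAl mxE mulr_ge0.
Qed.

Lemma psdmxD (n : nat) (A B : 'M[C]_n) :
  psdmx A -> psdmx B -> psdmx (A + B).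
Proof.
by move=> A_psd B_psd v; rewrite mulmxDr mulmxDl mxE addr_ge0.
Qed.

Lemma psdmx_sum (I : finType) (P : pred I) (n : nat) (F : I -> 'M[C]_n) :
  (forall i, P i -> psdmx (F i)) -> psdmx (\sum_(i | P i) F i).
Proof.
move=> F_psd v; rewrite mulmx_sumr mulmx_suml summxE.
by apply: sumr_ge0 => i /F_psd; apply.
Qed.

End Hermitian.

(** * Functional calculus of positive semidefinite matrices *)

Section SpectralCalculus.
Variables (C : numClosedFieldType) (n : nat) (A : 'M[C]_n).

Definition spectral_calculus (f : C -> C) : 'M[C]_n :=
  invmx (spectralmx A) *m diag_mx (map_mx f (spectral_diag A)) *m spectralmx A.

Lemma invsqrtmxE : invsqrtmx A = spectral_calculus (fun x => (sqrtC x)^-1).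
Proof. by []. Qed.

Lemma spectral_calculusM (f g : C -> C) :
  spectral_calculus f *m spectral_calculus g
    = spectral_calculus (fun x => f x * g x).
Proof.
rewrite /spectral_calculus !mulmxA mulmxK ?spectral_unit//.
rewrite -[_ *m diag_mx _ *m diag_mx _]mulmxA mulmx_diag.
by congr (_ *m diag_mx _ *m _); apply/rowP => j; rewrite !mxE.
Qed.

Lemma mxtrace_spectral_calculus (f : C -> C) :
  \tr (spectral_calculus f) = \sum_i f (spectral_diag A 0 i).
Proof.
rewrite /spectral_calculus mxtrace_mulC mulmxA mulmxV ?spectral_unit// mul1mx.
by rewrite mxtrace_diag; apply: eq_bigr => i _; rewrite mxE.
Qed.

Lemma spectral_calculus_trmxC (f : C -> C) :
  (spectral_calculus f)^t* = spectral_calculus (fun x => (f x)^*).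
Proof.
rewrite /spectral_calculus invmx_unitary ?spectral_unitarymx//.
rewrite !trmxC_mul trmxCK mulmxA tr_diag_mx map_diag_mx.
by congr (_ *m diag_mx _ *m _); apply/rowP => j; rewrite !mxE.
Qed.

Hypothesis A_herm : A^t* = A.

Lemma spectral_calculus_id : spectral_calculus id = A.
Proof.
have /orthomx_spectralP A_eq : A \is normalmx.
  by apply/normalmxP; rewrite A_herm.
by rewrite [RHS]A_eq /spectral_calculus map_mx_id.
Qed.

Hypothesis A_psd : psdmx A.

(** An eigenvalue is the quadratic form of [A] at a row of the unitary matrix [spectralmx A]. *)
Lemma spectral_diag_ge0 (i : 'I_n) : 0 <= spectral_diag A 0 i.
Proof.
have := psdmx_quad (delta_mx 0 i *m spectralmx A) A_psd.
have U := unitarymxP (spectral_unitarymx A).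
rewrite -[X in _ *m X *m _]spectral_calculus_id /spectral_calculus map_mx_id //.
rewrite invmx_unitary ?spectral_unitarymx// trmxC_mul trmx_delta map_delta_mx.
rewrite !mulmxA -(mulmxA (delta_mx 0 i)) U mulmx1.
rewrite -(mulmxA _ (spectralmx A)) U mulmx1.
by rewrite -rowE -colE !mxE eqxx mulr1n.
Qed.

(** Reduces matrix identities to scalar ones on x >= 0, where [sqrtC] is real. *)
Lemma eq_spectral_calculus (f g : C -> C) :
  (forall x, 0 <= x -> f x = g x) -> spectral_calculus f = spectral_calculus g.
Proof.
move=> fg; congr (_ *m diag_mx _ *m _); apply/rowP => j; rewrite !mxE.
exact/fg/spectral_diag_ge0.
Qed.

Lemma invsqrtmx_herm : (invsqrtmx A)^t* = invsqrtmx A.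
Proof.
rewrite invsqrtmxE spectral_calculus_trmxC; apply: eq_spectral_calculus => x x0.
by apply: geC0_conj; rewrite invr_ge0 sqrtC_ge0.
Qed.

(** The scalar function behind [P] is 0 at 0 and 1 at every other eigenvalue: [P] is the projection
    onto the support of [A]. *)
Lemma invsqrtmx_support_idem (P := invsqrtmx A *m A *m invsqrtmx A) :
  P *m P = P.
Proof.
rewrite {}/P -[X in invsqrtmx A *m X]spectral_calculus_id invsqrtmxE.
rewrite !spectral_calculusM.
apply: eq_spectral_calculus => x _.
have [->|x0] := eqVneq x 0; first by rewrite sqrtC0 invr0 !mul0r.
have : sqrtC x != 0 by rewrite sqrtC_eq0.
by move: (sqrtCK x); move: (sqrtC x) => y <- y0; field.
Qed.

(** At an eigenvalue x = y^2 the gap between the two sides is y (y + 2 s) (y - s)^2. Its double root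
    at y = s makes the bound tight when every nonzero eigenvalue is s^2. *)
Lemma mxtrace_invsqrtmx_lower (s : C) : 0 <= s ->
  3 * s ^+ 2 * \tr A - \tr (A *m A) <= 2 * s ^+ 3 * \tr (invsqrtmx A *m A).
Proof.
move=> s_ge0; rewrite invsqrtmxE.
have -> : \tr A = \tr (spectral_calculus id) by rewrite spectral_calculus_id.
have -> : A *m A = spectral_calculus id *m spectral_calculus id.
  by rewrite spectral_calculus_id.
rewrite -[X in _ <= _ * \tr (_ *m X)]spectral_calculus_id.
rewrite !spectral_calculusM !mxtrace_spectral_calculus !mulr_sumr -sumrB.
apply: ler_sum => i _; move: (spectral_diag_ge0 i).
move: (spectral_diag A 0 i) => x; rewrite -sqrtC_ge0.
move: (sqrtCK x); move: (sqrtC x) => y <- y_ge0.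
(* The convention 0^-1 = 0 keeps this true at y = 0. *)
have -> : y^-1 * y ^+ 2 = y.
  by have [->|y0] := eqVneq y 0; [rewrite expr2 !mulr0 | field].
rewrite -subr_ge0.
have -> : 2 * s ^+ 3 * y - (3 * s ^+ 2 * y ^+ 2 - y ^+ 2 * y ^+ 2)
    = y * (y + 2 * s) * (y - s) ^+ 2 by ring.
apply: mulr_ge0; first by rewrite mulr_ge0// addr_ge0// mulr_ge0.
by rewrite real_exprn_even_ge0 ?rpredB ?ger0_real.
Qed.

End SpectralCalculus.

(** * The pretty good measurement for flat states *)

Section FlatStates.
Variables (C : numClosedFieldType) (n : nat) (q : C).
Hypothesis q_gt0 : 0 < q.

(** The square of the Hermitian matrix Y = X T X - l X has nonnegative trace. By X^2 = q X and
    cyclicity, this trace is q^2 times the gap between the two sides. *)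
Lemma mxtrace_sandwich_lower (T X : 'M[C]_n) (l : C) :
  T^t* = T -> X^t* = X -> X *m X = q *: X -> l \is Num.real ->
  2 * l * \tr (T *m X) - l ^+ 2 / q * \tr X <= \tr (T *m X *m T *m X).
Proof.
move=> T_herm X_herm X_idem l_real.
pose Y := X *m T *m X - l *: X.
have Y_herm : Y^t* = Y.
  rewrite /Y raddfB raddfB /= trmxC_scale !trmxC_mul X_herm T_herm mulmxA.
  by rewrite (CrealP l_real).
have := mxtrace_mul_trmxC_ge0 Y; rewrite Y_herm.
have trXTX : \tr (X *m T *m X) = q * \tr (T *m X).
  by rewrite -mulmxA mxtrace_mulC -mulmxA X_idem -scalemxAr mxtraceZ.
have -> : \tr (Y *m Y) = q ^+ 2 * \tr (T *m X *m T *m X)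
    - 2 * l * q ^+ 2 * \tr (T *m X) + l ^+ 2 * q * \tr X.
  rewrite /Y mulmxBl !mulmxBr -!scalemxAl -!scalemxAr X_idem.
  rewrite !mulmxA -(mulmxA _ X X) !X_idem -?scalemxAr -?scalemxAl.
  rewrite !raddfB /= !mxtraceZ trXTX.
   rewrite -!mulmxA mxtrace_mulC -!mulmxA X_idem -!scalemxAr mxtraceZ.
  by ring.
move=> ge0; rewrite -(ler_pM2l (exprn_gt0 2 q_gt0)) -subr_ge0.
congr (0 <= _) : ge0; field; exact: lt0r_neq0.
Qed.

Variables (I : finType) (A : {set I}) (p : C) (sigma : I -> 'M[C]_n).
Variable e : I -> I -> C.
Hypothesis p_gt0 : 0 < p.
Hypothesis p_card : #|A|%:R * p = 1.
Hypothesis sigma_herm : {in A, forall i, (sigma i)^t* = sigma i}.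
Hypothesis sigma_idem : {in A, forall i, sigma i *m sigma i = q *: sigma i}.
Hypothesis sigma_tr1 : {in A, forall i, \tr (sigma i) = 1}.
Hypothesis sigma_tr2 :
  {in A &, forall i j, \tr (sigma i *m sigma j) = q * e i j}.

Let rho := \sum_(i in A) p *: sigma i.

Lemma flat_average_herm : rho^t* = rho.
Proof.
rewrite trmxC_sum; apply: eq_bigr => i iA.
by rewrite trmxC_scale sigma_herm// (CrealP (gtr0_real p_gt0)).
Qed.

Lemma flat_average_psd : psdmx rho.
Proof.
apply: psdmx_sum => i iA; apply/psdmxZ; first exact: ltW.
by apply: psdmx_hermitian_idem q_gt0 _ _; [exact: sigma_herm|exact: sigma_idem].
Qed.

(* The multiplier [s / p] in [mxtrace_sandwich_lower] is the optimal one when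
   the states are pairwise orthogonal. *)
Lemma flat_pgm_lower (T := invsqrtmx rho) :
  1 - p * \sum_(i in A) \sum_(j in A | i != j) e i j
    <= \sum_(i in A) p * \tr ((p *: (T *m sigma i *m T)) *m sigma i).
Proof.
have p0 := lt0r_neq0 p_gt0; have q0 := lt0r_neq0 q_gt0.
(* For pairwise orthogonal states p q is the only nonzero eigenvalue of [rho], so the scalar bound
   is made tight at s^2 = p q. *)
set E := p * _; pose s := sqrtC (p * q).
have s2 : s ^+ 2 = p * q by rewrite sqrtCK.
have s_gt0 : 0 < s by rewrite sqrtC_gt0 mulr_gt0.
have s0 := lt0r_neq0 s_gt0.
have tr_rho : \tr rho = 1.
  rewrite raddf_sum /= -p_card mulr_natl -sumr_const.
  by apply: eq_bigr => i iA; rewrite mxtraceZ sigma_tr1// mulr1.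
(* The diagonal pairs add up to #|A| p^2 q = s^2, the other pairs to s^2 E. *)
have tr_rho2 : \tr (rho *m rho) = s ^+ 2 * (1 + E).
  rewrite s2 mulmx_suml raddf_sum /=.
  transitivity (\sum_(i in A) (p ^+ 2 * q + p ^+ 2 * q *
      \sum_(j in A | i != j) e i j)).
    apply: eq_bigr => i iA; rewrite mulmx_sumr raddf_sum /=.
    rewrite (bigD1 i)//=; congr (_ + _).
      rewrite -scalemxAl -scalemxAr !mxtraceZ sigma_idem// mxtraceZ sigma_tr1//.
      by ring.
    rewrite mulr_sumr; apply: eq_big => [j|j /andP[jA _]].
      by rewrite eq_sym.
    by rewrite -scalemxAl -scalemxAr !mxtraceZ sigma_tr2//; ring.
  rewrite big_split /= sumr_const -mulr_sumr -(mulr_natl (p ^+ 2 * q)) /E.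
  rewrite (_ : _ * (p ^+ 2 * q) = (#|A|%:R * p) * (p * q)); last by ring.
  by rewrite p_card; ring.
have := mxtrace_invsqrtmx_lower flat_average_herm flat_average_psd (ltW s_gt0).
rewrite tr_rho tr_rho2 -/T mulr1 => main.
have T_herm : T^t* = T.
  exact: invsqrtmx_herm flat_average_herm flat_average_psd.
(* Multiplied by s^2 this is [main], since 3 s^2 - s^2 (1 + E) - s^2 = s^2 (1 - E). *)
apply: le_trans (_ : 2 * s * \tr (T *m rho) - 1 <= _).
  rewrite -(ler_pM2l (exprn_gt0 2 s_gt0)) -subr_ge0.
  by rewrite -subr_ge0 in main; congr (0 <= _) : main; ring.
(* The constant 1 is spread over [A] as #|A| p, and p = p^2 (s / p)^2 / q. *)
have -> : 2 * s * \tr (T *m rho) - 1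
    = \sum_(i in A) p ^+ 2 * (2 * (s / p) * \tr (T *m sigma i)
                              - (s / p) ^+ 2 / q * \tr (sigma i)).
  rewrite mulmx_sumr raddf_sum /= mulr_sumr.
  rewrite -[X in _ - X]p_card (mulr_natl p) -sumr_const -sumrB.
  apply: eq_bigr => i iA; rewrite -scalemxAr mxtraceZ sigma_tr1//.
  by rewrite exprMn s2; field; rewrite p0 q0.
apply: ler_sum => i iA; rewrite -scalemxAl mxtraceZ [leRHS]mulrA -expr2.
rewrite ler_pM2l ?exprn_gt0//.
apply: mxtrace_sandwich_lower => //; [exact: sigma_herm|exact: sigma_idem|].
by rewrite ger0_real// ltW// divr_gt0.
Qed.

End FlatStates.

(** * Success probabilities of flat ensembles with uniform real weights *)

Section FlatEnsembles.
Local Open Scope complex_scope.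

Lemma Re_ge0 (R : rcfType) (z : R[i]) : 0 <= z -> 0 <= complex.Re z.
Proof. by rewrite lecE => /andP[]. Qed.

Variables (R : realType) (I : finType) (A : {set I}) (n : nat) (p q : R).
Variable sigma : I -> 'M[R[i]]_n.
Hypothesis q_gt0 : 0 < q.
Hypothesis p_card : #|A|%:R * p = 1.
Hypothesis sigma_herm : {in A, forall i, (sigma i)^t* = sigma i}.
Hypothesis sigma_idem : {in A, forall i, sigma i *m sigma i = q%:C *: sigma i}.
Hypothesis sigma_tr1 : {in A, forall i, \tr (sigma i) = 1}.

Let qC_gt0 : 0 < q%:C. Proof. by rewrite ltcR. Qed.

Let p_gt0 : 0 < p.
Proof.
have A_gt0 : 0 < #|A|%:R :> R.
  rewrite lt0r ler0n andbT; apply/eqP => A0.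
  by move/eqP: p_card; rewrite A0 mul0r eq_sym oner_eq0.
by rewrite -(pmulr_rgt0 _ A_gt0) p_card.
Qed.

Let pC_gt0 : 0 < p%:C. Proof. by rewrite ltcR. Qed.

Let pC_card : #|A|%:R * p%:C = 1.
Proof. by rewrite -(rmorph_nat (real_complex R)) -rmorphM /= p_card. Qed.

Let weight := fun _ : I => p.
Let rho := avg_state A weight sigma.

Let rho_herm : rho^t* = rho.
Proof. exact: flat_average_herm pC_gt0 sigma_herm. Qed.

Let rho_psd : psdmx rho.
Proof. exact: (flat_average_psd qC_gt0 pC_gt0 sigma_herm sigma_idem). Qed.

Lemma flat_pgm_success_lower (e : I -> I -> R) :
  {in A &, forall i j, \tr (sigma i *m sigma j) = (q * e i j)%:C} ->
  1 - p * \sum_(i in A) \sum_(j in A | i != j) e i j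
    <= pgm_success A weight sigma.
Proof.
move=> sigma_tr2.
have tr2 : {in A &, forall i j, \tr (sigma i *m sigma j) = q%:C * (e i j)%:C}.
  by move=> i j iA jA; rewrite sigma_tr2// rmorphM.
have eC : \sum_(i in A) \sum_(j in A | i != j) (e i j)%:C
    = (\sum_(i in A) \sum_(j in A | i != j) e i j)%:C.
  by rewrite rmorph_sum; apply: eq_bigr => i _; rewrite rmorph_sum.
have := flat_pgm_lower qC_gt0 pC_gt0 pC_card sigma_herm sigma_idem sigma_tr1
  tr2.
rewrite /= eC -rmorphM -(rmorph1 (real_complex R)) -rmorphB /=.
(* The complex order equates imaginary parts and compares real parts; the latter comparison is the
   claim. *)
rewrite lecE => /andP[_] /= /le_trans; apply.
rewrite (raddf_sum (@complex.Re R : Rcomplex R -> R)).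
rewrite le_eqVlt; apply/orP; left; apply/eqP/eq_bigr => i iA.
rewrite /pgm; by case: (\tr _) => a b /=; rewrite mul0r subr0.
Qed.

Lemma flat_mxtrace_ge0 (M : 'M[R[i]]_n) i :
  i \in A -> psdmx M -> 0 <= \tr (M *m sigma i).
Proof.
move=> iA M_psd.
have -> : sigma i = q%:C^-1 *: (sigma i *m sigma i).
  by rewrite sigma_idem// scalerA mulVf ?scale1r// gt_eqF.
rewrite -scalemxAr mxtraceZ mulr_ge0 ?invr_ge0 ?(ltW qC_gt0)//.
exact: psdmx_mxtrace_sandwich_ge0 M_psd (sigma_herm iA).
Qed.

(** Positivity of the other outcomes bounds each tr (M_i sigma_i) by tr sigma_i = 1. This is the
    upper bound needed to compare with the supremum in [opt_success]. *)
Lemma povm_success_le1 (M : I -> 'M[R[i]]_n) :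
  povm A M -> success_prob A weight sigma M <= 1.
Proof.
move=> [M_psd M_sum]; rewrite -p_card (mulr_natl p) -sumr_const.
apply: ler_sum => i iA; rewrite /weight ler_piMr ?(ltW p_gt0)//.
have : \tr (M i *m sigma i) <= 1.
  rewrite -(sigma_tr1 iA) -[X in _ <= \tr X]mul1mx -M_sum mulmx_suml raddf_sum.
  rewrite (bigD1 i)//= lerDl; apply: sumr_ge0 => j /andP[jA _].
  exact: flat_mxtrace_ge0 iA (M_psd _ jA).
by rewrite lecE => /andP[].
Qed.

(** On the whole space the pretty good measurement sums only to the support projection [P]. Adding
    the complement Q = 1 - P to one arbitrary outcome [i0] completes it to a POVM without lowering
    the success probability. *)
Lemma pgm_success_le_opt :
  pgm_success A weight sigma <= opt_success A weight sigma.
Proof.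
pose T := invsqrtmx rho.
have T_herm : T^t* = T by exact: invsqrtmx_herm.
pose P := T *m rho *m T.
pose Q := 1%:M - P.
have P_sum : \sum_(i in A) pgm A weight sigma i = P.
  rewrite /P /rho /avg_state mulmx_sumr mulmx_suml; apply: eq_bigr => i _.
  by rewrite -scalemxAr -scalemxAl.
have Q_idem : Q *m Q = Q.
  rewrite /Q mulmxBl !mulmxBr !mulmx1 mul1mx invsqrtmx_support_idem//.
  by rewrite subrr subr0.
have Q_herm : Q^t* = Q.
  rewrite /Q raddfB raddfB /= trmx1 map_mx1 /P.
  by rewrite (trmxC_mul (T *m rho)) (trmxC_mul T) T_herm rho_herm mulmxA.
have Q_psd : psdmx Q.
  by apply: (psdmx_hermitian_idem ltr01) => //; rewrite scale1r.
have [i0 i0A] : exists i0, i0 \in A.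
  apply/set0Pn/eqP => A0; move/eqP: p_card.
  by rewrite A0 cards0 mul0r eq_sym oner_eq0.
pose M i := pgm A weight sigma i + (if i == i0 then Q else 0).
have pgm_psd i : i \in A -> psdmx (pgm A weight sigma i).
  move=> iA; apply/psdmxZ; first exact: ltW.
  rewrite -/T -[X in X *m _ *m _]T_herm; apply: psdmx_sandwich.
  exact: psdmx_hermitian_idem qC_gt0 (sigma_herm iA) (sigma_idem iA).
have M_povm : povm A M.
  split=> [i iA|].
    apply: psdmxD; first exact: pgm_psd.
    case: ifP => _; first exact: Q_psd.
    by move=> v; rewrite mulmx0 mul0mx mxE.
  transitivity (P + Q); last by rewrite /Q addrC subrK.
  rewrite big_split; congr (_ + _); first exact: P_sum.
  rewrite -big_mkcondr (big_pred1 i0) => [//|i /=].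
  by case: eqVneq => [->|]; rewrite ?i0A ?andbF.
apply: le_trans (_ : success_prob A weight sigma M <= _).
  apply: ler_sum => i iA; rewrite ler_pM2l// /M mulmxDl raddfD /=.
  rewrite (raddfD (@complex.Re R : Rcomplex R -> R)) lerDl; apply: Re_ge0.
  case: ifP => _; first exact: flat_mxtrace_ge0 iA Q_psd.
  by rewrite mul0mx mxtrace0.
apply: ub_le_sup; last by exists M.
by exists 1 => _ [N N_povm ->]; exact: povm_success_le1.
Qed.

End FlatEnsembles.

(** * Hidden shift states *)

Section TensorPowers.

Lemma tensmxZ (K : comPzRingType) (m n p q : nat) (a b : K)
    (A : 'M[K]_(m, n)) (B : 'M[K]_(p, q)) :
  (a *: A) *t (b *: B) = (a * b) *: (A *t B).
Proof. by apply/matrixP => i j; rewrite !mxE mulrACA. Qed.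

Lemma mxtrace_delta (K : pzRingType) (n : nat) (i j : 'I_n) :
  \tr (delta_mx i j : 'M[K]_n) = (i == j)%:R.
Proof.
rewrite /mxtrace (bigD1 i)//= mxE eqxx big1 ?addr0// => l li.
by rewrite mxE (negbTE li).
Qed.

Lemma mxtrace_tens (K : comPzRingType) (m n : nat)
    (A : 'M[K]_m) (B : 'M[K]_n) : \tr (A *t B) = \tr A * \tr B.
Proof.
rewrite /mxtrace mulr_sum; apply: eq_bigr => i _.
by case: (mxtens_indexP i) => j l; rewrite tensmxE mxtens_indexK.
Qed.

Lemma tensmx_trmxC (C : numClosedFieldType) (m n p q : nat)
    (A : 'M[C]_(m, n)) (B : 'M[C]_(p, q)) : (A *t B)^t* = A^t* *t B^t*.
Proof. by rewrite trmx_tens map_mxT. Qed.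

Variables (C : numClosedFieldType) (d : nat).
Implicit Types A B : 'M[C]_d.

Lemma tenspow_trmxC A k : (tenspow A k)^t* = tenspow (A^t*) k.
Proof.
elim: k => [|k IHk] /=; first by rewrite trmx1 map_mx1.
by rewrite tensmx_trmxC IHk.
Qed.

Lemma tenspow_mul A B k : tenspow A k *m tenspow B k = tenspow (A *m B) k.
Proof.
elim: k => [|k IHk] /=; first by rewrite mulmx1.
by rewrite tensmx_mul IHk.
Qed.

Lemma tenspowZ (a : C) A k : tenspow (a *: A) k = a ^+ k *: tenspow A k.
Proof.
elim: k => [|k IHk] /=; first by rewrite scale1r.
by rewrite IHk tensmxZ exprS.
Qed.

Lemma mxtrace_tenspow A k : \tr (tenspow A k) = \tr A ^+ k.
Proof.
elim: k => [|k IHk] /=; first by rewrite mxtrace1.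
by rewrite mxtrace_tens IHk exprS.
Qed.

End TensorPowers.

(** * Entries and character of the regular representation *)

Section RegularRepresentation.
Variables (C : numClosedFieldType) (gT : finGroupType) (G : {group gT}).
Local Notation reg := (regular_repr C G).

Lemma regular_reprE x i j : x \in G ->
  reg x i j = (enum_val j == enum_val i * x)%g%:R.
Proof.
move=> xG; rewrite /= !mxE eqxx /=; congr (_ : bool)%:R.
apply/eqP/eqP => [->|<-]; last by rewrite gring_valK.
by rewrite gring_indexK// groupM ?enum_valP.
Qed.

Lemma regular_repr_trmxC x : x \in G -> (reg x)^t* = reg x^-1%g.
Proof.
move=> xG; apply/matrixP => i j.
rewrite (regular_reprE _ _ (groupVr xG)) mxE [_^T i j]mxE regular_reprE//.
rewrite conjC_nat; congr (_ : bool)%:R.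
by apply/eqP/eqP => ->; rewrite ?mulgK ?mulgKV.
Qed.

(** The trace counts fixed points of right multiplication by [x], an action that is free. *)
Lemma mxtrace_regular_repr x : x \in G ->
  \tr (reg x) = if x == 1%g then #|G|%:R else 0.
Proof.
move=> xG; rewrite /mxtrace.
transitivity (\sum_(i < #|G|) (x == 1%g)%:R : C).
  apply: eq_bigr => i _; rewrite regular_reprE//.
  by rewrite -{1}[enum_val i]mulg1 (inj_eq (mulgI _)) eq_sym.
by rewrite sumr_const card_ord; case: eqP => _; rewrite ?mul0rn.
Qed.

End RegularRepresentation.

(** * One copy: flatness and pairwise overlaps *)

Section HiddenShiftStates.
Variables (R : realType) (gT : finGroupType) (G : {group gT}).
Local Notation C := R[i].
Local Notation N := #|G|.
Local Notation reg := (regular_repr C G).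
Local Notation rho := (hidden_shift_state R G).

Let N_neq0 : N%:R != 0 :> C.
Proof. by rewrite pnatr_eq0 -lt0n cardG_gt0. Qed.

Let shiftG g (b c : 'I_N) : g \in G -> (g ^+ b * g ^- c)%g \in G.
Proof. by move=> gG; rewrite groupM ?groupV ?groupX. Qed.

(** Taking adjoints exchanges the roles of [b] and [c] in each term. *)
Lemma hidden_shift_state_herm h : h \in G -> (rho h)^t* = rho h.
Proof.
move=> hG; rewrite /hidden_shift_state trmxC_scale geC0_conj ?invr_ge0 ?ler0n//.
congr (_ *: _); rewrite trmxC_sum exchange_big /=; apply: eq_bigr => b _.
rewrite trmxC_sum; apply: eq_bigr => c _.
rewrite tensmx_trmxC trmx_delta map_delta_mx regular_repr_trmxC ?shiftG//.
by rewrite invMg invgK.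
Qed.

Lemma hidden_shift_state_mulE g h :
  rho g *m rho h = ((N * N)%:R ^+ 2)^-1 *:
    \sum_(b < N) \sum_(c < N) \sum_(b' < N) \sum_(c' < N)
      (delta_mx b c *m delta_mx b' c') *t
      (reg (g ^+ b * g ^- c)%g *m reg (h ^+ b' * h ^- c')%g).
Proof.
rewrite -scalemxAl -scalemxAr scalerA -expr2 exprVn; congr (_ *: _).
rewrite mulmx_suml; apply: eq_bigr => b _.
rewrite mulmx_suml; apply: eq_bigr => c _.
rewrite mulmx_sumr; apply: eq_bigr => b' _.
rewrite mulmx_sumr; apply: eq_bigr => c' _.
by rewrite tensmx_mul.
Qed.

(** Only b' = c survives, and then h^(b-c) h^(c-c') = h^(b-c') no longer depends on [c], whose
    summation gives a factor |G|. *)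
Lemma hidden_shift_state_idem h : h \in G ->
  rho h *m rho h = N%:R^-1 *: rho h.
Proof.
move=> hG; rewrite hidden_shift_state_mulE /hidden_shift_state.
transitivity (((N * N)%:R ^+ 2)^-1 *: (N%:R *:
    \sum_(b < N) \sum_(c' < N)
       delta_mx b c' *t reg (h ^+ b * h ^- c')%g)); last first.
  by rewrite !scalerA natrM; congr (_ *: _); field.
congr (_ *: _); rewrite scaler_sumr; apply: eq_bigr => b _.
transitivity (\sum_(c < N) \sum_(c' < N)
    delta_mx b c' *t reg (h ^+ b * h ^- c')%g); last first.
  by rewrite sumr_const card_ord scaler_nat.
apply: eq_bigr => c _; rewrite (bigD1 c)//= [X in _ + X]big1 ?addr0.
  apply: eq_bigr => c' _; rewrite mul_delta_mx -repr_mxM ?shiftG//.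
  by rewrite mulgA mulgKV.
move=> b' b'c; apply: big1 => c' _.
by rewrite mul_delta_mx_0 1?eq_sym// tens0mx.
Qed.

Lemma hidden_shift_state_tr1 h : h \in G -> \tr (rho h) = 1.
Proof.
move=> hG; rewrite mxtraceZ raddf_sum /=.
transitivity ((N * N)%:R^-1 * \sum_(b < N) N%:R : C); last first.
  rewrite sumr_const card_ord -(mulr_natl N%:R) -natrM mulVf//.
  by rewrite natrM mulf_neq0.
congr (_ * _); apply: eq_bigr => b _; rewrite raddf_sum /=.
rewrite (bigD1 b)//= [X in _ + X]big1 ?addr0 => [|c cb].
  rewrite mxtrace_tens mxtrace_delta eqxx mulgV mxtrace_regular_repr//.
  by rewrite eqxx mul1r.
by rewrite mxtrace_tens mxtrace_delta eq_sym (negbTE cb) mul0r.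
Qed.

(** For fixed [c], putting b = d + c turns the argument into g^d h^-d, whose trace is |G| when g^d =
    h^d and 0 otherwise. Each [c] thus contributes |G|^2 r(g,h). *)
Lemma sum_shift_eq (g h : gT) : g \in G -> h \in G ->
  \sum_(b < N) \sum_(c < N) \tr (reg (g ^+ b * g ^- c * (h ^+ c * h ^- b))%g)
    = N%:R ^+ 3 * (agreement R G g h)%:C%C.
Proof.
move=> gG hG; rewrite exchange_big /=.
transitivity (\sum_(c < N) N%:R ^+ 2 * (agreement R G g h)%:C%C : C);
  last first.
  by rewrite sumr_const card_ord -[LHS]mulr_natl mulrA -exprS.
apply: eq_bigr => c _.
(* Reducing d + c modulo |G| is harmless, as x^|G| = 1 in [G]. *)
pose shift (d : 'I_N) : 'I_N := Ordinal (ltn_pmod (d + c) (cardG_gt0 G)).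
have shift_inj : injective shift.
  move=> d d' /(congr1 val) /= /eqP; rewrite eqn_modDr !modn_small// => /eqP.
  exact: val_inj.
rewrite (reindex_inj shift_inj).
have expg_shift x d : x \in G -> (x ^+ shift d * x ^- c)%g = (x ^+ d)%g.
  by move=> xG; rewrite /= (expg_mod _ (expg_cardG xG)) expgnDr mulgK.
transitivity (\sum_(d < N) if (h ^+ d == g ^+ d)%g then N%:R else 0 : C).
  apply: eq_bigr => d _; have shiftK := expg_shift _ d.
  have -> : (h ^+ c * h ^- shift d = (h ^+ d)^-1)%g.
    by rewrite -shiftK// invMg invgK.
  rewrite shiftK// mxtrace_regular_repr ?groupM ?groupV ?groupX//.
  by rewrite -eq_mulgV1 eq_sym.
rewrite -big_mkcond /= sumr_const -[LHS]mulr_natl.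
rewrite rmorphM fmorphV !rmorph_nat cardsE expr2.
by rewrite -mulrA [N%:R * (_ / _)]mulrC divfK// mulrC.
Qed.

(** The matrix units force b' = c, and their trace forces c' = b, which leaves the double sum of
    [sum_shift_eq]. *)
Lemma hidden_shift_state_tr2 g h : g \in G -> h \in G ->
  \tr (rho g *m rho h) = (N%:R^-1 * agreement R G g h)%:C%C.
Proof.
move=> gG hG; rewrite hidden_shift_state_mulE mxtraceZ.
have aux (F : fieldType) (x a : F) : x != 0 ->
    ((x * x) ^+ 2)^-1 * (x ^+ 3 * a) = x^-1 * a by move=> x0; field.
transitivity (((N * N)%:R ^+ 2)^-1 *
    (N%:R ^+ 3 * (agreement R G g h)%:C%C) : C); last first.
  by rewrite [in RHS]rmorphM fmorphV rmorph_nat natrM;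
    exact: (aux R[i] _ _ N_neq0).
congr (_ * _); rewrite -sum_shift_eq// raddf_sum; apply: eq_bigr => b _.
rewrite raddf_sum; apply: eq_bigr => c _.
rewrite raddf_sum (bigD1 c)//= [X in _ + X]big1 ?addr0 => [|b' b'c].
  rewrite raddf_sum (bigD1 b)//= [X in _ + X]big1 ?addr0 => [|c' c'b].
    rewrite mxtrace_tens mul_delta_mx mxtrace_delta eqxx mul1r.
    by rewrite -(repr_mxM reg) ?shiftG//.
  by rewrite mxtrace_tens mul_delta_mx mxtrace_delta eq_sym (negbTE c'b) mul0r.
rewrite raddf_sum; apply: big1 => c' _.
by rewrite mul_delta_mx_0 1?eq_sym// tens0mx raddf0.
Qed.

End HiddenShiftStates.

(** * Several copies, as a flat ensemble with q = |G|^-k *)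

Section HiddenShiftCopies.
Variables (R : realType) (gT : finGroupType) (G : {group gT}) (k : nat).
Local Notation N := #|G|.
Local Notation sigma := (hidden_shift_copies R G k).
Local Notation q := (N%:R^-1 ^+ k : R).

Let qC : q%:C%C = N%:R^-1 ^+ k.
Proof. by rewrite rmorphXn fmorphV rmorph_nat. Qed.

Lemma hidden_shift_copies_herm : {in G, forall h, (sigma h)^t* = sigma h}.
Proof.
by move=> h hG; rewrite tenspow_trmxC hidden_shift_state_herm.
Qed.

Lemma hidden_shift_copies_idem :
  {in G, forall h, sigma h *m sigma h = q%:C%C *: sigma h}.
Proof.
by move=> h hG; rewrite tenspow_mul hidden_shift_state_idem// tenspowZ qC.
Qed.

Lemma hidden_shift_copies_tr1 : {in G, forall h, \tr (sigma h) = 1}.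
Proof.
by move=> h hG; rewrite mxtrace_tenspow hidden_shift_state_tr1// expr1n.
Qed.

Lemma hidden_shift_copies_tr2 : {in G &, forall g h,
  \tr (sigma g *m sigma h) = (q * agreement R G g h ^+ k)%:C%C}.
Proof.
move=> g h gG hG; rewrite tenspow_mul mxtrace_tenspow hidden_shift_state_tr2//.
by rewrite -exprMn rmorphXn.
Qed.

Let q_gt0 : 0 < q.
Proof. by rewrite exprn_gt0// invr_gt0 ltr0n cardG_gt0. Qed.

Let p_card : N%:R * N%:R^-1 = 1 :> R.
Proof. by rewrite mulfV// pnatr_eq0 -lt0n cardG_gt0. Qed.

Lemma hidden_shift_pgm_lower :
  1 - N%:R^-1 * \sum_(g in G) \sum_(h in G | g != h) agreement R G g h ^+ k
    <= hidden_shift_pgm R G k.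
Proof.
exact: flat_pgm_success_lower q_gt0 p_card hidden_shift_copies_herm
  hidden_shift_copies_idem hidden_shift_copies_tr1 _ hidden_shift_copies_tr2.
Qed.

Lemma hidden_shift_pgm_le_opt :
  hidden_shift_pgm R G k <= hidden_shift_opt R G k.
Proof.
exact: pgm_success_le_opt q_gt0 p_card hidden_shift_copies_herm
  hidden_shift_copies_idem hidden_shift_copies_tr1.
Qed.

End HiddenShiftCopies.

Lemma is_least_exists (P : nat -> Prop) (k : nat) :
  P k -> exists2 l, is_least P l & (l <= k)%N.
Proof.
move=> Pk; have exP : exists l, `[< P l >] by exists k; apply/asboolP.
have [l /asboolP Pl l_min] := ex_minnP exP.
by exists l; [split=> // j Pj|]; apply/l_min/asboolP.
Qed.

(** * Bounds on the agreement ratios *)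

Section Agreement.
Variables (R : realType) (gT : finGroupType) (G : {group gT}).
Local Notation N := #|G|.
Local Notation r := (agreement R G).

Let N_gt0 : 0 < N%:R :> R.
Proof. by rewrite ltr0n cardG_gt0. Qed.

Lemma agreement_ge0 g h : 0 <= r g h.
Proof. by rewrite divr_ge0. Qed.

Lemma agreement_le1 g h : r g h <= 1.
Proof.
by rewrite ler_pdivrMr// mul1r ler_nat -[leqRHS]card_ord max_card.
Qed.

(* The exponent 1 already distinguishes [g] from [h]. *)
Lemma agreement_le_pred g h : g \in G -> h \in G -> g != h ->
  r g h <= 1 - N%:R^-1.
Proof.
move=> gG hG gh.
have N_gt1 : (1 < N)%N.
  rewrite (cardD1 g) gG (cardD1 h) !inE hG eq_sym gh//.
rewrite ler_pdivrMr// mulrBl mul1r mulVf ?gt_eqF// lerBrDr natr1 ler_nat.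
rewrite -[leqRHS]card_ord; apply/proper_card/properP; split.
  exact/subset_predT.
by exists (Ordinal N_gt1); rewrite ?inE//= !expg1 eq_sym.
Qed.

(** Powers of a base in (0, 1] decrease with the exponent, and k / 2 <= k; a zero ratio is treated
    apart. *)
Lemma agreement_exp_le_powR g h k : (1 <= k)%N ->
  r g h ^+ k <= r g h `^ (k%:R / 2).
Proof.
move=> k_gt0; have k_gt0R : 0 < k%:R :> R by rewrite ltr0n.
have := agreement_ge0 g h; rewrite le_eqVlt => /orP[/eqP<-|r_gt0].
  by rewrite expr0n -leqn0 leqNgt k_gt0 powR_ge0.
rewrite -powR_mulrn ?(ltW r_gt0)//; apply: ger_powR.
  by rewrite r_gt0 agreement_le1.
lra.
Qed.

(** There are at most |G|^2 pairs, each with ratio at most z = 1 - 1/|G| < 1, so the normalized sum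
    is at most |G| z^k, which tends to 0. Hence the minimum over [k] in the theorem exists. *)
Lemma agreement_sum_small (eps : R) : 0 < eps -> exists k, (1 <= k)%N /\
  N%:R^-1 * \sum_(g in G) \sum_(h in G | g != h) r g h ^+ k <= eps.
Proof.
move=> eps_gt0; pose z : R := 1 - N%:R^-1.
have Ninv_le1 : N%:R^-1 <= 1 :> R by rewrite invf_le1// ler1n cardG_gt0.
have z_ge0 : 0 <= z by rewrite subr_ge0.
have z_lt1 : `|z| < 1.
  by rewrite ger0_norm// ltrBlDr ltrDl invr_gt0.
have /cvgrPdist_lt z_cvg := cvg_expr z_lt1.
(* The successor of the threshold [k0] is taken to get a positive exponent. *)
have [|k0 _ /(_ k0.+1 (leqnSn _)) /=] := z_cvg (eps / N%:R).
  by rewrite divr_gt0.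
rewrite sub0r normrN ger0_norm ?exprn_ge0// ltr_pdivlMr// => zk.
exists k0.+1; split=> //; apply: le_trans (ltW zk).
rewrite mulrC ler_pdivrMr//.
apply: le_trans (_ : \sum_(g in G) z ^+ k0.+1 * N%:R <= _); last first.
  by rewrite sumr_const -[leLHS]mulr_natr.
apply: ler_sum => g gG.
apply: le_trans (_ : \sum_(h in G) z ^+ k0.+1 <= _); last first.
  by rewrite sumr_const mulr_natr.
rewrite big_mkcondr; apply: ler_sum => h hG; case: ifP => gh.
  by rewrite lerXn2r ?nnegrE ?agreement_ge0// agreement_le_pred.
by rewrite exprn_ge0.
Qed.

End Agreement.

Theorem corollary9 (R : realType) :
  (forall (gT : finGroupType) (G : {group gT}) (k : nat), (1 <= k)%N ->
     1 - hidden_shift_pgm R G k <=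
       #|G|%:R^-1 * \sum_(g in G) \sum_(h in G | g != h)
                      agreement R G g h `^ (k%:R / 2))
  /\
  (exists eps : R, 0 < eps /\
     forall (gT : finGroupType) (G : {group gT}),
       exists kmin k1 : nat,
         [/\ sample_complexity R G kmin,
             is_least (fun k => (1 <= k)%N /\
               #|G|%:R^-1 * \sum_(g in G) \sum_(h in G | g != h)
                              agreement R G g h ^+ k <= eps) k1
           & (kmin <= k1)%N]).
Proof.
split=> [gT G k k_gt0|].
  apply: le_trans (_ : #|G|%:R^-1 * \sum_(g in G) \sum_(h in G | g != h)
      agreement R G g h ^+ k <= _).
    by rewrite lerBlDr addrC -lerBlDr hidden_shift_pgm_lower.
  rewrite ler_wpM2l ?invr_ge0//; apply: ler_sum => g _; apply: ler_sum => h _.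
  exact: agreement_exp_le_powR.
(* 1/3 is the failure probability allowed by the success threshold 2/3. *)
exists (1 / 3); split=> [|gT G]; first lra.
pose small k := (1 <= k)%N /\ #|G|%:R^-1 * \sum_(g in G) \sum_(h in G | g != h)
  agreement R G g h ^+ k <= 1 / 3.
pose enough k := (1 <= k)%N /\ 2 / 3 <= hidden_shift_opt R G k.
have [k0 k0_small] : exists k, small k by apply: agreement_sum_small; lra.
have [k1 k1_least _] := is_least_exists k0_small.
have [[k1_gt0 sum_le] _] := k1_least.
(* The index [k1] itself reaches success 2/3, which gives both the existence of [kmin] and the bound
   by [k1]. *)
have k1_enough : enough k1.
  split=> //; apply: le_trans (hidden_shift_pgm_le_opt R G k1).
  by apply: le_trans (hidden_shift_pgm_lower R G k1); lra.
have [kmin kmin_least kmin_le] := is_least_exists k1_enough.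
by exists kmin, k1.
Qed.
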